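(* Let $\sigma\in\{124\text{-}3,\ 134\text{-}2\}$. Define $F_1(z,x)=zx+\sum_{n\ge2}\sum_{\pi\in\mathcal{S}_n(\sigma),\,\pi_1>\pi_2} z^n x^{\pi_1}$ and $F_2(z,x)=\sum_{n\ge2}\sum_{\pi\in\mathcal{S}_n(\sigma),\,\pi_1<\pi_2} z^n x^{\pi_1}$. Define linear operators on $\mathbb{Q}[[z,x]]$ by their action on monomials (extended linearly): $P_{21}: z^n x^b\mapsto \sum_{a=b+1}^{n+1} z^{n+1}x^a$; $P_{132}: z^n x^c\mapsto \sum_{a=1}^{c}\sum_{b=c+2}^{n+2} z^{n+2}x^a$; $P_{231}: z^n x^c\mapsto \sum_{a=c+1}^{n+1}\sum_{b=a+1}^{n+2} z^{n+2}x^a$; $P_{123}: z^n x^a\mapsto z^{n+1}x^a$. Then $F_1(z,x)=zx+P_{21}\circ F_1(z,x)$ and $F_2(z,x)=z^2x+P_{132}\circ F_1(z,x)+P_{231}\circ F_1(z,x)+P_{123}\circ F_2(z,x)$.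
   Context: A vincular pattern is a permutation $\rho\in\mathcal{S}_m$ written with dashes between some consecutive entries; $\pi\in\mathcal{S}_n$ contains it if there are indices $i_1<\cdots<i_m$ with $\pi_{i_1}\cdots\pi_{i_m}$ order-isomorphic to $\rho$ and $i_{j+1}=i_j+1$ whenever $\rho_j,\rho_{j+1}$ are not separated by a dash; otherwise $\pi$ avoids it. $\mathcal{S}_n(\rho)$ is the set of $\rho$-avoiding permutations in $\mathcal{S}_n$. Thus $124\text{-}3$ and $134\text{-}2$ require the first three letters of an occurrence to be adjacent.
   Formalization: The printed equations are false (at z^3x^2, from 213, the left side of the first is 1, the right 0); the theorem proved applies P_21, P_132 and P_231 to F_1+F_2 instead of F_1, with P_123 still applied to F_2. *)

(* Defs.v *)
From HB Require Import structures.
From mathcomp Require Import all_boot all_order all_fingroup all_algebra.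
From mathcomp Require Import boolp classical_sets functions cardinality fsbigop.
From mathcomp Require Import zify.

Set Implicit Arguments.
Unset Strict Implicit.
Unset Printing Implicit Defensive.

Import Order.TTheory GRing.Theory Num.Theory.
Local Open Scope ring_scope.

(* Permutations of {1, ..., n} are elements of 'S_n, which acts on
   {0, ..., n-1}; [word] and [letter] restore the 1-based one-line notation. *)
Definition word n (pi : 'S_n) : seq nat := [seq (pi i).+1 | i <- enum 'I_n].

Definition letter n (pi : 'S_n) (j : nat) : nat := nth 0%N (word pi) j.-1.

(* The permutation with the given one-line word; the identity if w is not the
   word of a permutation of {1, ..., n.+1}. *)
Definition one_line n (w : seq nat) : 'S_n.+1 :=
  insubd (1%g : 'S_n.+1) [ffun i : 'I_n.+1 => inord (nth 0%N w i).-1 : 'I_n.+1].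

(* [j \in dashes] means that there is a dash between the letters of (0-based)
   indices j and j+1. *)
Record vincular m := Vincular { vperm : 'S_m; dashes : {set 'I_m} }.

Definition occurrence m n (rho : vincular m) (pi : 'S_n)
    (i : {ffun 'I_m -> 'I_n}) : bool :=
  [&& [forall j : 'I_m, forall k : 'I_m, (j < k)%N ==> (i j < i k)%N],
      [forall j : 'I_m, forall k : 'I_m,
         (pi (i j) < pi (i k))%N == (vperm rho j < vperm rho k)%N]
    & [forall j : 'I_m, forall k : 'I_m,
         ((k == j.+1 :> nat) && (j \notin dashes rho))
           ==> (i k == (i j).+1 :> nat)]].

Definition contains m n (rho : vincular m) (pi : 'S_n) : bool :=
  [exists i, occurrence rho pi i].

Definition Av m (rho : vincular m) n : {set 'S_n} :=
  [set pi | ~~ contains rho pi].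

Definition vinc_124_3 : vincular 4 :=
  Vincular (one_line 3 [:: 1; 2; 4; 3]%N) [set inord 2%N].

Definition vinc_134_2 : vincular 4 :=
  Vincular (one_line 3 [:: 1; 3; 4; 2]%N) [set inord 2%N].

(* Q[[z,x]]: F n a is the coefficient of z^n x^a.  The vector space structure
   is the pointwise one. *)
Notation series := (nat -> nat -> rat^o).

Definition monomial (n a : nat) : series :=
  fun m b => ((m == n) && (b == a))%:R.

(* The linear extension to Q[[z,x]] of z^n x^b |-> K n b, namely
   F |-> \sum_(n, b) F n b *: K n b, computed coefficientwise.  For a locally
   finite K each coefficient is a finite sum; the finitely supported sum below
   is 0 by convention otherwise. *)
Definition locally_finite (K : nat -> nat -> series) : Prop :=
  forall m a : nat, finite_set [set p : nat * nat | K p.1 p.2 m a != 0]%classic.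

Definition extend (K : nat -> nat -> series) (F : series) : series :=
  fun m a => \sum_(p \in [set: nat * nat]%classic) F p.1 p.2 * K p.1 p.2 m a.

Definition K21 (n b : nat) : series :=
  \sum_(b.+1 <= a < n.+2) monomial n.+1 a.

Definition K132 (n c : nat) : series :=
  \sum_(1 <= a < c.+1) \sum_(c.+2 <= b < n.+3) monomial n.+2 a.

Definition K231 (n c : nat) : series :=
  \sum_(c.+1 <= a < n.+2) \sum_(a.+1 <= b < n.+3) monomial n.+2 a.

Definition K123 (n a : nat) : series := monomial n.+1 a.

Definition P21 : series -> series := extend K21.
Definition P132 : series -> series := extend K132.
Definition P231 : series -> series := extend K231.
Definition P123 : series -> series := extend K123.

(* \sum_(n >= 2) \sum_(pi \in Av sigma n | d pi) z^n x^(pi_1), with like terms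
   collected. *)
Definition first_letter_gf m (sigma : vincular m)
    (d : forall n, 'S_n -> bool) : series :=
  fun n a =>
    if (2 <= n)%N
    then #|[set pi in Av sigma n | d n pi & letter pi 1%N == a]|%:R else 0.

(* Deleting pi_1 when pi_1 > pi_2, or pi_1 and pi_2 when pi_1 < pi_2 > pi_3,
   leaves a permutation that may start with a descent or an ascent.  Hence P21,
   P132 and P231 have to be applied to F1 + F2: the identity with P21 F1 alone
   fails at z^3 x^2 (pi = 213), where the left side is 1 and the right side 0. *)
Definition F1 m (sigma : vincular m) : series :=
  monomial 1%N 1%N
  + first_letter_gf sigma (fun n pi => (letter pi 2%N < letter pi 1%N)%N).

Definition F2 m (sigma : vincular m) : series :=
  first_letter_gf sigma (fun n pi => (letter pi 1%N < letter pi 2%N)%N).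


Lemma word_one_line n (w : seq nat) :
  perm_eq w (iota 1 n.+1) -> word (one_line n w) = w.
Proof.
move=> pw; have sw : size w = n.+1 by rewrite (perm_size pw) size_iota.
have w_bnd (i : 'I_n.+1) : (0 < nth 0%N w i <= n.+1)%N.
  have : nth 0%N w i \in iota 1 n.+1 by rewrite -(perm_mem pw) mem_nth ?sw.
  by rewrite mem_iota.
have w_inord (i : 'I_n.+1) :
    (inord (nth 0%N w i).-1 : 'I_n.+1).+1 = nth 0%N w i.
  by have /andP[w0 wn] := w_bnd i; rewrite inordK prednK.
have inj : injectiveb [ffun i : 'I_n.+1 => inord (nth 0%N w i).-1 : 'I_n.+1].
  apply/injectiveP => i j; rewrite !ffunE => /(congr1 (fun k : 'I__ => k.+1)).
  rewrite !w_inord => /eqP; rewrite nth_uniq ?sw ?ltn_ord //.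
    by move/eqP; apply: val_inj.
  by rewrite (perm_uniq pw) iota_uniq.
have ptE i : one_line n w i = inord (nth 0%N w i).-1.
  by rewrite /one_line /insubd insubT -pvalE /= ffunE.
apply: (@eq_from_nth _ 0%N) => [|i]; rewrite /word size_map size_enum_ord ?sw//.
move=> lt_in; rewrite (nth_map ord0) ?size_enum_ord // ptE w_inord.
by rewrite nth_enum_ord.
Qed.

Lemma word_vinc_124_3 : word (vperm vinc_124_3) = [:: 1; 2; 4; 3]%N.
Proof. exact: word_one_line. Qed.

Lemma word_vinc_134_2 : word (vperm vinc_134_2) = [:: 1; 3; 4; 2]%N.
Proof. exact: word_one_line. Qed.

Lemma extendE (K : nat -> nat -> series) (F : series) m a :
  extend K F m a =
  \sum_(p \in [set p : nat * nat | K p.1 p.2 m a != 0]%classic)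
    F p.1 p.2 * K p.1 p.2 m a.
Proof.
apply/esym/fsbig_widen => // p [_ /= /negP]; rewrite negbK => /eqP ->.
by rewrite mulr0.
Qed.

Lemma extend_linear (K : nat -> nat -> series) :
  locally_finite K -> linear (extend K).
Proof.
move=> Kfin c F G; apply/funext => m; apply/funext => a.
have -> : (c *: extend K F + extend K G) m a =
          c * extend K F m a + extend K G m a by [].
rewrite !extendE mulr_fsumr -fsbig_split; last exact: Kfin.
by apply: eq_fsbigr => p _; rewrite mulrA; exact: mulrDl.
Qed.

Lemma extend_monomial (K : nat -> nat -> series) n b :
  extend K (monomial n b) = K n b.
Proof.
apply/funext => m; apply/funext => a; rewrite /extend.
rewrite -(@fsbig_widen _ _ _ _ [set (n, b)]%classic) //.
  by rewrite fsbig_set1 /monomial !eqxx mul1r.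
move=> -[n' b'] /= [_ neq]; rewrite /monomial.
case: eqVneq => [en|_]; case: eqVneq => [eb|_]; rewrite ?mul0r //.
by case: neq; rewrite en eb.
Qed.

Lemma locally_finite_bnd (K : nat -> nat -> series) :
  (forall n b m a, K n b m a != 0 -> (n <= m)%N /\ (b <= m + a)%N) ->
  locally_finite K.
Proof.
move=> Kbnd m a.
apply: sub_finite_set (finite_setX (finite_II m.+1) (finite_II (m + a).+1)).
by move=> -[n b] /= /Kbnd [].
Qed.

Lemma sum_series_neq0 (I : eqType) (r : seq I) (f : I -> series) m a :
  (\sum_(i <- r) f i) m a != 0 -> exists2 i, i \in r & f i m a != 0.
Proof.
rewrite !fct_sumE => nz; apply/hasP; apply: contraNT nz => /hasPn f0.
by rewrite big_seq big1 // => i /f0; rewrite negbK => /eqP.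
Qed.

Lemma monomial_neq0 n a m b : monomial n a m b != 0 -> m = n /\ b = a.
Proof.
rewrite /monomial; case: (eqVneq m n) => [->|_]; case: (eqVneq b a) => [->|_];
  by rewrite ?eqxx.
Qed.

Lemma locally_finite_K21 : locally_finite K21.
Proof.
apply: locally_finite_bnd => n b m a /sum_series_neq0 [i].
by rewrite mem_index_iota => /andP[? ?] /monomial_neq0 [-> ->]; lia.
Qed.

Lemma locally_finite_K132 : locally_finite K132.
Proof.
apply: locally_finite_bnd => n c m a /sum_series_neq0 [i] + /sum_series_neq0 [j].
rewrite !mem_index_iota => /andP[? ?] /andP[? ?] /monomial_neq0 [-> ->]; lia.
Qed.

Lemma locally_finite_K231 : locally_finite K231.
Proof.
apply: locally_finite_bnd => n c m a /sum_series_neq0 [i] + /sum_series_neq0 [j].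
rewrite !mem_index_iota => /andP[? ?] /andP[? ?] /monomial_neq0 [-> ->]; lia.
Qed.

Lemma locally_finite_K123 : locally_finite K123.
Proof.
by apply: locally_finite_bnd => n c m a /monomial_neq0 [-> ->]; lia.
Qed.

(* Main.v *)
(* Deleting the first letter of a word that starts with a descent, or the first
   two letters of one that starts a < b > d, affects no occurrence, since an
   occurrence starts with two adjacent ascents; conversely all choices of the
   deleted letters are allowed.  If a word starts a < b < c, avoidance at its
   first letter says that no letter has a value strictly between b and c (for
   124-3) or between a and b (for 134-2), so b = c - 1, respectively b = a + 1.
   Hence b is redundant, and deleting it is a bijection onto the avoiders that
   start with an ascent from the letter a. *)
Require Import Defs.
From mathcomp Require Import all_boot all_order all_fingroup all_algebra.
From mathcomp Require Import boolp classical_sets functions cardinality fsbigop.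
From mathcomp Require Import zify.

Set Implicit Arguments.
Unset Strict Implicit.
Unset Printing Implicit Defensive.

Import Order.TTheory GRing.Theory Num.Theory.
Local Open Scope ring_scope.

(** * One-line words of permutations and recursion on the first letter *)

Section Words.
Local Open Scope nat_scope.

Lemma size_word n (s : 'S_n) : size (word s) = n.
Proof. by rewrite size_map size_enum_ord. Qed.

Lemma nth_word n (s : 'S_n) (i : 'I_n) : nth 0 (word s) i = (s i).+1.
Proof. by rewrite (nth_map i) ?size_enum_ord // nth_ord_enum. Qed.

Lemma perm_word n (s : 'S_n) : perm_eq (word s) (iota 1 n).
Proof.
have uw : uniq (word s).
  rewrite map_inj_uniq ?enum_uniq // => i j [] /val_inj.
  exact: perm_inj.
apply: uniq_perm; rewrite ?iota_uniq //.
suff sub : {subset word s <= iota 1 n}.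
  by case: (uniq_min_size uw sub); rewrite ?size_word ?size_iota.
by move=> x /mapP[i _ ->]; rewrite mem_iota; have := ltn_ord (s i); lia.
Qed.

Lemma word_lift0 n (a : 'I_n.+1) (s : 'S_n) :
  word (lift_perm ord0 a s) = a.+1 :: map (bump a.+1) (word s).
Proof.
rewrite /word enum_ordSl /= lift_perm_id -!map_comp; congr (_ :: _).
by apply: eq_map => i /=; rewrite lift_perm_lift /= bumpS.
Qed.

(** A first letter and a shorter permutation determine the longer one through [lift_perm]. This map
    is injective and both sides have [(n+1)!] elements, so it is a bijection, and deleting the first
    letter becomes a reindexing of sums. *)
Lemma big_word_recl n (f : seq nat -> nat) :
  (\sum_(s : 'S_n.+1) f (word s) =
   \sum_(0 <= a < n.+1) \sum_(s : 'S_n) f (a.+1 :: map (bump a.+1) (word s))).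
Proof.
rewrite big_mkord pair_big /= (reindex (fun p => lift_perm ord0 p.1 p.2)) /=.
  by apply: eq_bigr => p _; rewrite word_lift0.
apply: onW_bij; apply: inj_card_bij => [[a s] [b t] /= /permP eq_st|].
  have eab : a = b by have := eq_st ord0; rewrite !lift_perm_id.
  subst b; congr pair; apply/permP => i.
  by have := eq_st (lift ord0 i); rewrite !lift_perm_lift => /lift_inj.
by rewrite card_prod !card_Sn card_ord factS.
Qed.

Lemma sum_nat_eq_val m (x : nat) (f : nat -> nat) :
  (x < m) -> (\sum_(0 <= b < m) (x == b) * f b = f x).
Proof.
move=> lt_xm; rewrite (bigD1_seq x) ?mem_index_iota ?iota_uniq //= eqxx mul1n.
by rewrite big1 ?addn0 // => b; rewrite eq_sym => /negPf->.
Qed.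

Lemma big_word_head n (P : pred (seq nat)) a : (0 < a <= n.+1) ->
  (\sum_(s : 'S_n.+1) (P (word s) && (nth 0 (word s) 0 == a)) =
   \sum_(s : 'S_n) P (a :: map (bump a) (word s))).
Proof.
case: a => // a lt_an.
rewrite (big_word_recl _ (fun w => nat_of_bool (P w && (nth 0 w 0 == a.+1)))).
rewrite -(@sum_nat_eq_val n.+1 a
  (fun b => \sum_(s : 'S_n) P (b.+1 :: map (bump b.+1) (word s)))) //.
apply: eq_bigr => b _; rewrite big_distrr; apply: eq_bigr => s _ /=.
by rewrite eqSS eq_sym andbC mulnb.
Qed.

Lemma nth0_word n (s : 'S_n.+1) : (0 < nth 0 (word s) 0 <= n.+1).
Proof. by rewrite (nth_word s ord0) /=. Qed.

Lemma big_word_head_out n (P : pred (seq nat)) a : ~~ (0 < a <= n.+1) ->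
  (\sum_(s : 'S_n.+1) (P (word s) && (nth 0 (word s) 0 == a)) = 0).
Proof.
move=> a_out; rewrite big1 // => s _; case: eqP => [e|]; rewrite ?andbF //.
by move: a_out; rewrite -e nth0_word.
Qed.

Lemma nth_word_neq n (s : 'S_n) i j : (i < n) -> (j < n) -> i != j ->
  nth 0 (word s) i != nth 0 (word s) j.
Proof.
move=> lt_i lt_j; rewrite nth_uniq ?size_word //.
by rewrite (perm_uniq (perm_word s)) iota_uniq.
Qed.

Lemma word_consP n (s : 'S_n.+1) : exists b t, word s = b :: t.
Proof. by case E: (word s) (size_word s) => [|b t] //; exists b, t. Qed.

Lemma bump_mono h : {mono bump h : x y / (x < y)}.
Proof. by move=> x y; rewrite /bump; lia. Qed.

(** * Avoidance on words, and counts of avoiders by first letter and initial shape *)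

Section Avoid.

(* [p a b c x] says that the adjacent letters a, b, c and the later letter x
   form an occurrence of the pattern. *)
Variable p : nat -> nat -> nat -> nat -> bool.

(** Occurrences are sorted by the position of their first letter; only those that start at [a] are
    excluded here, which makes avoidance recursive. *)
Definition free_at (a : nat) (t : seq nat) : bool :=
  if t is b :: c :: v then ~~ has (p a b c) v else true.

Fixpoint avoids (w : seq nat) : bool :=
  if w is a :: t then free_at a t && avoids t else true.

Lemma avoidsPn w :
  reflect (exists i k, [/\ (i.+2 < k), (k < size w) &
     p (nth 0 w i) (nth 0 w i.+1) (nth 0 w i.+2) (nth 0 w k)]) (~~ avoids w).
Proof.
elim: w => [|a t IH] /=; first by constructor => -[i [k []]].
rewrite negb_and; apply: (iffP orP) => [[nfree|/IH[i [k [? ? ?]]]]|].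
- case: t nfree {IH} => [|b [|c v]] //=; rewrite negbK => /(has_nthP 0)[k].
  by exists 0, k.+3.
- by exists i.+1, k.+1.
case=> [[|i]] [[|k]] [] // lt_ik lt_k pk; last first.
  by right; apply/IH; exists i, k.
left; case: t lt_k pk {IH} => [|b [|c v]] //=; rewrite ?ltnS; try by lia.
case: k lt_ik => [|[|k]] //= _ lt_k pk; rewrite negbK.
by apply/(has_nthP 0); exists k.
Qed.

Hypothesis p_lt : forall a b c x, p a b c x -> (a < b < c).
Hypothesis p_homo : forall f : nat -> nat, {mono f : x y / (x < y)} ->
  forall a b c x, p (f a) (f b) (f c) (f x) = p a b c x.

Lemma free_at_map f a t : {mono f : x y / (x < y)} ->
  free_at (f a) (map f t) = free_at a t.
Proof.
move=> fmono; case: t => [|b [|c v]] //=; rewrite has_map; congr negb.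
by apply: eq_has => x /=; rewrite p_homo.
Qed.

Lemma avoids_map f w : {mono f : x y / (x < y)} ->
  avoids (map f w) = avoids w.
Proof. by move=> fmono; elim: w => //= a t ->; rewrite free_at_map. Qed.

(** Avoidance depends on relative order only, so raising letters to make room for [a] does not
    affect the tail; only occurrences at the new letter remain to be tested. *)
Lemma avoids_cons_bump a u :
  avoids (a :: map (bump a) u) = free_at a (map (bump a) u) && avoids u.
Proof. by rewrite /= avoids_map //; exact: bump_mono. Qed.

Lemma avoids_cons2_bump a b u :
  avoids [:: a, bump a b & map (bump a) (map (bump b) u)] =
  [&& free_at a (bump a b :: map (bump a) (map (bump b) u)),
      free_at b (map (bump b) u) & avoids u].
Proof. by rewrite -avoids_cons_bump -map_cons -avoids_cons_bump. Qed.

(** By [p_lt] an occurrence starts with two ascents; a missing first ascent, or in [free_at_peak] a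
    missing second one, excludes every occurrence at [a]. *)
Lemma free_at_desc a b t : (b <= a) -> free_at a (b :: t).
Proof.
case: t => //= c v le_ba; apply/hasPn => x _.
by apply/negP => /p_lt; lia.
Qed.

Lemma free_at_peak a b c t : (c <= b) -> free_at a [:: b, c & t].
Proof.
move=> le_cb; apply/hasPn => x _.
by apply/negP => /p_lt; lia.
Qed.

Definition num_head n b : nat :=
  \sum_(s : 'S_n) (avoids (word s) && (nth 0 (word s) 0 == b)).

Definition num_desc n a : nat :=
  \sum_(s : 'S_n) (avoids (word s) && (nth 0 (word s) 1 < nth 0 (word s) 0)
                   && (nth 0 (word s) 0 == a)).

Definition num_asc n a : nat :=
  \sum_(s : 'S_n) (avoids (word s) && (nth 0 (word s) 0 < nth 0 (word s) 1)
                   && (nth 0 (word s) 0 == a)).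

Definition num_peak n a : nat :=
  \sum_(s : 'S_n) ([&& avoids (word s), nth 0 (word s) 0 < nth 0 (word s) 1
                     & nth 0 (word s) 2 < nth 0 (word s) 1]
                   && (nth 0 (word s) 0 == a)).

Definition num_asc2 n a : nat :=
  \sum_(s : 'S_n) ([&& avoids (word s), nth 0 (word s) 0 < nth 0 (word s) 1
                     & nth 0 (word s) 1 < nth 0 (word s) 2]
                   && (nth 0 (word s) 0 == a)).

Lemma num_head_split n b : num_head n.+2 b = (num_desc n.+2 b + num_asc n.+2 b).
Proof.
rewrite -big_split; apply: eq_bigr => s _ /=.
have := @nth_word_neq _ s 0 1 isT isT isT.
by case: (avoids _); rewrite //= neq_ltn; case: ltngtP => // _ _; case: eqP.
Qed.

Lemma num_asc_split n b : num_asc n.+3 b = (num_peak n.+3 b + num_asc2 n.+3 b).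
Proof.
rewrite -big_split; apply: eq_bigr => s _ /=.
have := @nth_word_neq _ s 1 2 isT isT isT.
by case: (avoids _); rewrite //= neq_ltn;
  case: (nth 0 (word s) 0 < nth 0 (word s) 1); rewrite //=;
  case: (ltngtP (nth 0 (word s) 1)) => // _ _; case: eqP.
Qed.

(** Groups avoiders by first letter, so that the recurrences below can be checked one permutation at
    a time. No word has the letter 0, so the term [b = 0] is harmless. *)
Lemma sum_num_head n (f : nat -> nat) :
  (\sum_(0 <= b < n.+2) num_head n.+1 b * f b =
   \sum_(s : 'S_n.+1) avoids (word s) * f (nth 0 (word s) 0)).
Proof.
under eq_bigr do rewrite /num_head big_distrl /=.
rewrite exchange_big; apply: eq_bigr => s _ /=.
have /andP[_ lt_s] := nth0_word s.
rewrite -(@sum_nat_eq_val n.+2 _ f lt_s) big_distrr /=.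
by apply: eq_bigr => b _; rewrite mulnA mulnb.
Qed.

(** Putting [a] in front of an avoider with first letter [b] creates a descent exactly when [b < a],
    and then no occurrence can start at [a]. *)
Lemma num_desc_recl n a :
  (num_desc n.+2 a =
   \sum_(0 <= b < n.+2) num_head n.+1 b * (b < a <= n.+2)).
Proof.
rewrite (sum_num_head _ (fun b => nat_of_bool (b < a <= n.+2))).
pose P w := avoids w && (nth 0 w 1 < nth 0 w 0).
have [a_in|a_out] := boolP (0 < a <= n.+2); last first.
  rewrite /num_desc (big_word_head_out P) //.
  by rewrite big1 // => s _; apply/eqP; rewrite muln_eq0 eqb0; lia.
rewrite /num_desc (big_word_head P) //.
apply: eq_bigr => s _; have [b [t ->]] := word_consP s.
rewrite mulnb; congr nat_of_bool; rewrite /P avoids_cons_bump.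
set A := free_at a _; rewrite /=.
have -> : (bump a b < a) = (b < a <= n.+2) by rewrite /bump; lia.
case: (boolP (b < a <= n.+2)) => [lt_ba|]; rewrite ?andbF // !andbT.
by rewrite /A free_at_desc //; rewrite /bump; lia.
Qed.

(** First the top [b.+1], then [a] is put in front of an avoider with first letter [c]. The start is
    a peak iff [c <= b] and [a <= b.+1], and then neither new letter starts an occurrence. *)
Lemma num_peak_recl n a :
  (num_peak n.+3 a = \sum_(0 <= c < n.+2)
     num_head n.+1 c * \sum_(0 <= b < n.+2) ((0 < a <= b.+1) && (c <= b))).
Proof.
rewrite (sum_num_head _
  (fun c => \sum_(0 <= b < n.+2) ((0 < a <= b.+1) && (c <= b)))).
pose P w := [&& avoids w, (nth 0 w 0 < nth 0 w 1) & (nth 0 w 2 < nth 0 w 1)].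
have [a_in|a_out] := boolP (0 < a <= n.+3); last first.
  rewrite /num_peak (big_word_head_out P) // big1 // => s _.
  rewrite big_nat big1 ?muln0 // => b lt_b.
  by apply/eqP; rewrite eqb0; lia.
rewrite /num_peak (big_word_head P) //.
rewrite (big_word_recl _ (fun w => P (a :: map (bump a) w))) exchange_big.
apply: eq_bigr => s _ /=; rewrite big_distrr; apply: eq_bigr => b _ /=.
rewrite mulnb /P avoids_cons2_bump; have [c [t ->]] := word_consP s.
congr nat_of_bool.
set A := free_at a _; set B := free_at b.+1 _; rewrite /=.
rewrite bump_mono.
have -> : (bump b.+1 c < b.+1) = (c <= b) by rewrite /bump; lia.
have -> : (a < bump a b.+1) = (0 < a <= b.+1) by rewrite /bump; lia.
case: (boolP ((0 < a <= b.+1) && (c <= b))) => [/andP[le_ab le_cb]|];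
  rewrite ?andbF // !andbT.
rewrite /A /B free_at_peak ?free_at_desc //; rewrite /bump; lia.
Qed.

(* [mid a c] is the only b for which the letters a and b may be inserted in
   front of a word u with first letter c >= a so that the result starts with two
   ascents.  The insertion raises b to b + 1 and c to c + 2, so the choices c
   for 124-3 and a for 134-2 make b, c resp. a, b consecutive values. *)
Variable mid : nat -> nat -> nat.
Hypothesis free_mid : forall n (s : 'S_n.+1) a b, let u := word s in
  (0 < a <= nth 0 u 0) -> (0 < b) ->
  [&& free_at a (map (bump a) (b :: map (bump b) u)),
      free_at b (map (bump b) u), (a <= b) & (b <= nth 0 u 0)]
  = (mid a (nth 0 u 0) == b) && free_at a (map (bump a) u).
Hypothesis mid_in : forall a c, (0 < a <= c) -> (0 < mid a c <= c).

(** For fixed [a] and remaining word [u], [free_mid] admits a single middle letter, and with it the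
    conditions reduce to those on [a] in front of [u]. Summing over the middle letter therefore
    counts each shorter word once. *)
Lemma num_asc2_recl n a : num_asc2 n.+3 a = num_asc n.+2 a.
Proof.
pose P w := [&& avoids w, (nth 0 w 0 < nth 0 w 1) & (nth 0 w 1 < nth 0 w 2)].
pose Q w := avoids w && (nth 0 w 0 < nth 0 w 1).
have [a_in|a_out] := boolP (0 < a <= n.+2); last first.
  rewrite /num_asc (big_word_head_out Q) //.
  (* The first letter is below the second, which is at most [n + 3]; hence it is at most [n + 2]. *)
  apply: big1 => s _; apply/eqP; rewrite eqb0; apply: contra a_out.
  case/andP => /and3P[_ lt1 lt2] /eqP <-.
  have := nth0_word s; have := ltn_ord (s (inord 1)).
  rewrite -ltnS -nth_word inordK //; lia.
rewrite /num_asc2 (big_word_head P); last by lia.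
rewrite /num_asc (big_word_head Q) //.
rewrite (big_word_recl _ (fun w => P (a :: map (bump a) w))) exchange_big.
apply: eq_bigr => s _ /=.
set u := word s; have u_in : 0 < nth 0 u 0 <= n.+1 := nth0_word s.
have [c [t uE]] := word_consP s; have uc : nth 0 u 0 = c by rewrite /u uE.
have PE b : P [:: a, bump a b.+1 & map (bump a) (map (bump b.+1) u)] =
    [&& mid a c == b.+1, a <= c, free_at a (map (bump a) u) & avoids u].
  rewrite /P avoids_cons2_bump; set A := free_at a _; set B := free_at b.+1 _.
  have -> : nth 0 [:: a, bump a b.+1 & map (bump a) (map (bump b.+1) u)] 2
      = bump a (bump b.+1 c) by rewrite /u uE.
  rewrite /= bump_mono.
  have -> : (a < bump a b.+1) = (a <= b.+1) by rewrite /bump; lia.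
  have -> : (b.+1 < bump b.+1 c) = (b.+1 <= c) by rewrite /bump; lia.
  have [le_ac|lt_ca] := leqP a c; last by rewrite andbF; apply/negbTE; lia.
  have := @free_mid _ s a b.+1; cbv zeta.
  rewrite -/u uc map_cons => /(_ _ isT) => E.
  rewrite andTb [RHS]andbA -E; last by lia.
  rewrite -/A -/B.
  by case: A; case: B; case: (avoids u); rewrite /= ?andbT ?andbF.
under eq_bigr do rewrite PE.
rewrite /Q avoids_cons_bump.
have -> : nth 0 (a :: map (bump a) u) 1 = bump a c by rewrite /u uE.
rewrite /=; have -> : (a < bump a c) = (a <= c) by rewrite /bump; lia.
have [le_ac|lt_ca] := leqP a c; last by rewrite big1 => *; rewrite ?andbF.
(* As [1 <= mid a c <= c <= n + 1], its predecessor [m] lies in the summation range, so exactly one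
   term survives. *)
have := @mid_in a c; rewrite le_ac; case: (mid a c) => [|m]; first by lia.
move=> mP; under eq_bigr do rewrite eqSS -mulnb.
by rewrite sum_nat_eq_val ?andbT //; lia.
Qed.

End Avoid.

(** * The two patterns and their forced middle letters *)

Definition p124_3 a b c x := [&& a < b, b < x & x < c].
Definition p134_2 a b c x := [&& a < x, x < b & b < c].

(** All values from 1 to the length occur, and one below the first letter must occur later; this
    supplies the last letter of a forbidden occurrence. *)
Lemma mem_behead_word n (s : 'S_n.+1) x :
  0 < x < nth 0 (word s) 0 -> x \in behead (word s).
Proof.
move=> x_in; have := nth0_word s; have := perm_mem (perm_word s) x.
have [c [t uE]] := word_consP s; rewrite mem_iota uE /= in x_in *.
by rewrite in_cons => + c_in; case: eqP => //=; lia.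
Qed.

Lemma free_mid_124_3 n (s : 'S_n.+1) a b : let u := word s in
  (0 < a <= nth 0 u 0) -> (0 < b) ->
  [&& free_at p124_3 a (map (bump a) (b :: map (bump b) u)),
      free_at p124_3 b (map (bump b) u), (a <= b) & (b <= nth 0 u 0)]
  = (nth 0 u 0 == b) && free_at p124_3 a (map (bump a) u).
Proof.
rewrite /= => a_in b_gt0; have memt := @mem_behead_word n s b.
have [c [t uE]] := word_consP s; rewrite uE /= in a_in memt *.
have [lt_bc|lt_cb|eq_cb] := ltngtP b c; first 2 last.
(* The second and third letters are now [c + 1] and [c + 2], with no value between them. The tests
   at [b] and, on the right, at [a] both say that no later letter of [u] lies strictly between [c]
   and the second letter of [u]. *)
- subst b; have -> : a <= c by lia.
  rewrite !andbT andTb; set A := (X in X && _); have -> : A = true.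
    rewrite /A; apply/hasPn => x _; rewrite /p124_3 /bump; lia.
  case: t {uE memt A} => //= d v; rewrite !has_map; congr negb.
  by apply: eq_has => x; rewrite /= /p124_3 /bump; lia.
(* The letter [b] of the tail becomes [b + 2], strictly between the second letter [b + 1] and the
   third letter [c + 2]. *)
- rewrite /=; have [le_ab|] := leqP a b; rewrite ?andbF // !andbT.
  apply/negbTE/nandP; left; rewrite negbK !has_map; apply/hasP; exists b.
    by apply: memt; lia.
  by rewrite /= /p124_3 /bump; lia.
- by rewrite !andbF.
Qed.

Lemma free_mid_134_2 n (s : 'S_n.+1) a b : let u := word s in
  (0 < a <= nth 0 u 0) -> (0 < b) ->
  [&& free_at p134_2 a (map (bump a) (b :: map (bump b) u)),
      free_at p134_2 b (map (bump b) u), (a <= b) & (b <= nth 0 u 0)]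
  = (a == b) && free_at p134_2 a (map (bump a) u).
Proof.
rewrite /= => a_in b_gt0; have memt := @mem_behead_word n s a.
have [c [t uE]] := word_consP s; rewrite uE /= in a_in memt *.
have [lt_ab|lt_ba|eq_ab] := ltngtP a b; first 2 last.
- subst b; have -> : a <= c by lia.
  rewrite !andbT andTb; set A := (X in X && _); have -> // : A = true.
  by rewrite /A; apply/hasPn => x _; rewrite /p134_2 /bump; lia.
(* The letter [a] of the tail becomes [a + 1], strictly between the first letter [a] and the second
   letter [b + 1]. *)
- have [le_bc|] := leqP b c; rewrite ?andbF // !andbT.
  apply/negbTE/nandP; left; rewrite negbK !has_map; apply/hasP; exists a.
    by apply: memt; lia.
  by rewrite /= /p134_2 /bump; lia.
- by rewrite !andbF.
Qed.

(** * Occurrences in permutations as occurrences in words *)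

Definition order_iso m (u v : seq nat) :=
  forall j k, j < m -> k < m ->
  (nth 0 u j < nth 0 u k) = (nth 0 v j < nth 0 v k).

Lemma containsP (rho : vincular 4) n (pi : 'S_n) :
  dashes rho = [set inord 2] ->
  reflect (exists i k, [/\ i.+2 < k, k < n &
     order_iso 4 [seq nth 0 (word pi) l | l <- [:: i; i.+1; i.+2; k]]
       (word (vperm rho))])
  (contains rho pi).
Proof.
move=> dE; apply: (iffP existsP) => [[f /and3P[]]|].
  move=> /forallP f_mono /forallP f_iso /forallP f_adj.
  (* The only dash follows index 2, so the first and the last position determine the occurrence. *)
  have adj j : j < 2 -> f (inord j.+1) = (f (inord j)).+1 :> nat.
    move=> lt_j2; have /forallP/(_ (inord j.+1)) := f_adj (inord j).
    rewrite dE inE -val_eqE /= !inordK; lia.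
  have f1 := adj 0 isT; have f2 := adj 1 isT; rewrite f1 in f2.
  exists (f (inord 0)), (f (inord 3)); split=> //.
    have /forallP/(_ (inord 3))/implyP := f_mono (inord 2).
    by rewrite !inordK // f2 => ->.
  have fE j : j < 4 ->
      nth 0 [seq nth 0 (word pi) l
        | l <- [:: val (f (inord 0)); (f (inord 0)).+1; (f (inord 0)).+2;
                   val (f (inord 3))]] j
      = (pi (f (inord j))).+1.
    rewrite -nth_word.
    by case: j => [|[|[|[|]]]] //= _; rewrite ?f1 ?f2.
  move=> j k lt_j lt_k; rewrite !fE //.
  have /forallP/(_ (inord k))/eqP := f_iso (inord j).
  rewrite ltnS => ->.
  rewrite -[in RHS](inordK lt_j) -[in RHS](inordK lt_k).
  by rewrite !(nth_word (vperm rho)).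
move=> [i [k [lt_ik lt_k iso]]].
case: n pi lt_k iso => // n pi lt_k iso.
pose g (j : nat) := if j < 3 then i + j else k.
have g_lt j : g j < n.+1 by rewrite /g; case: (ltnP j 3) => ?; lia.
exists [ffun j : 'I_4 => inord (g j)]; apply/and3P; split;
  apply/forallP => j; apply/forallP => l;
  rewrite ?ffunE.
- rewrite !inordK ?g_lt // /g; have := ltn_ord l.
  by case: (ltnP j 3) => ?; case: (ltnP l 3) => ?; lia.
- have gE (h : 'I_4) : nth 0 [seq nth 0 (word pi) l
        | l <- [:: i; i.+1; i.+2; k]] h = (pi (inord (g h))).+1.
    rewrite -nth_word inordK ?g_lt //.
    by case: h => [[|[|[|[|]]]]] //= _; rewrite /g /= ?addn0 ?addn1 ?addn2.
  have := iso j l (ltn_ord j) (ltn_ord l); rewrite !gE.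
  by rewrite !(nth_word (vperm rho)) !ltnS => ->.
- rewrite dE inE -val_eqE /= !inordK ?g_lt //.
  rewrite /g; have := ltn_ord l.
  by case: (ltnP j 3) => ?; case: (ltnP l 3) => ?; lia.
Qed.

Lemma contains_avoids p (rho : vincular 4) n (pi : 'S_n) :
  dashes rho = [set inord 2] ->
  (forall a b c x,
    reflect (order_iso 4 [:: a; b; c; x] (word (vperm rho))) (p a b c x)) ->
  contains rho pi = ~~ avoids p (word pi).
Proof.
move=> dE pP; apply/(containsP _ dE)/avoidsPn.
  by move=> [i [k [? ? /= /pP pik]]]; exists i, k; rewrite size_word.
by move=> [i [k [? lt_k /pP pik]]]; rewrite size_word in lt_k; exists i, k.
Qed.

Lemma p124_3P a b c x :
  reflect (order_iso 4 [:: a; b; c; x] (word (vperm vinc_124_3)))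
    (p124_3 a b c x).
Proof.
rewrite word_vinc_124_3; apply: (iffP and3P) => [[? ? ?]|iso].
  by move=> [|[|[|[|j]]]] [|[|[|[|k]]]] //=; lia.
(* Sorted by value, the letters of 1243 sit at indices 0, 1, 3, 2; comparing neighbours gives the
   chain. *)
by have := (iso 0 1 isT isT, iso 1 3 isT isT, iso 3 2 isT isT) => -[] -[] /=.
Qed.

Lemma p134_2P a b c x :
  reflect (order_iso 4 [:: a; b; c; x] (word (vperm vinc_134_2)))
    (p134_2 a b c x).
Proof.
rewrite word_vinc_134_2; apply: (iffP and3P) => [[? ? ?]|iso].
  by move=> [|[|[|[|j]]]] [|[|[|[|k]]]] //=; lia.
by have := (iso 0 3 isT isT, iso 3 1 isT isT, iso 1 2 isT isT) => -[] -[] /=.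
Qed.

(** * Multiplicities and coefficients of the operators *)

Lemma sum_leq_nat N L : \sum_(0 <= b < N) (L <= b) = N - L.
Proof. by elim: N => [|N IH]; rewrite ?big_nil // big_nat_recr //= IH; lia. Qed.

(** The tops are the [b] with [b >= max(a - 1, c)]. The case [a <= c] is the start 132 and [c < a]
    the start 231, with the multiplicities of [K132] and [K231]. *)
Lemma sum_peak_tops n a c : \sum_(0 <= b < n.+1) ((0 < a <= b.+1) && (c <= b)) =
  (0 < a <= c) * (n.+1 - c) + (c < a <= n.+1) * (n.+2 - a).
Proof.
case: a => [|a]; first by rewrite big1 ?ltn0.
rewrite (eq_bigr (fun b => nat_of_bool (maxn a c <= b))) => [|b _]; last first.
  by rewrite geq_max.
by rewrite sum_leq_nat; lia.
Qed.

End Words.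

(** The weight [f] stands for the inner sums of [K132] and [K231], whose terms do not depend on
    [b]. *)
Lemma sum_monomial i j m (f : nat -> nat) m' a' :
  (\sum_(i <= a < j) monomial m a *+ f a) m' a' =
  (((m' == m) && (i <= a' < j)) * f a')%N%:R.
Proof.
rewrite !fct_sumE.
have E k a : (monomial m a *+ k) m' a' = (((m' == m) && (a' == a)) * k)%N%:R.
  elim: k => [|k IH]; first by rewrite mulr0n muln0.
  by rewrite mulrS mulnS natrD -IH.
under eq_bigr do rewrite E.
rewrite -natr_sum; congr _%:R.
case: (boolP (i <= a' < j)%N) => [a'_in|a'_out].
  rewrite (bigD1_seq a') ?mem_index_iota ?iota_uniq //=.
  by rewrite eqxx big1 ?addn0 // => b; rewrite eq_sym => /negPf->; rewrite andbF.
rewrite andbF big_nat big1 // => b b_in.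
have [e|_] := eqVneq a' b; rewrite ?andbF //.
by rewrite e b_in in a'_out.
Qed.

Lemma K21E n b m a : K21 n b m a = ((m == n.+1) && (b < a <= n.+1)%N)%:R.
Proof. by rewrite /K21 (sum_monomial _ _ _ (fun=> 1%N)) muln1. Qed.

Lemma K132E n c m a :
  K132 n c m a = (((m == n.+2) && (0 < a <= c)) * (n.+1 - c))%N%:R.
Proof.
rewrite /K132; under eq_bigr do rewrite sumr_const_nat.
by rewrite (sum_monomial _ _ _ (fun=> _)).
Qed.

Lemma K231E n c m a :
  K231 n c m a = (((m == n.+2) && (c < a <= n.+1)) * (n.+2 - a))%N%:R.
Proof.
rewrite /K231; under eq_bigr do rewrite sumr_const_nat.
by rewrite (sum_monomial _ _ _ (fun a => n.+3 - a.+1)%N).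
Qed.

(** Each operator raises the degree in z by a constant, so a coefficient of the image reads a single
    row of [F]. *)
Lemma extend_row (K : nat -> nat -> series) (F : series) m a n0 B :
  (forall n b, K n b m a != 0 -> n = n0 /\ (b < B)%N) ->
  extend K F m a = \sum_(0 <= b < B) F n0 b * K n0 b m a.
Proof.
move=> Ksupp; rewrite big_mkord.
rewrite (@fsbig_ord _ _ _ B (fun b => F n0 b * K n0 b m a)).
rewrite -(reindex_fsbig (fun b => (n0, b)) `I_B
  [set p | p.1 = n0 /\ (p.2 < B)%N]%classic
  (fun p => F p.1 p.2 * K p.1 p.2 m a)).
apply/esym/fsbig_widen => // -[n b] [_ /= out].
have [->|/Ksupp //] := eqVneq (K n b m a) 0; exact: mulr0.
split => [b /= //|b c _ _ []//|[n b] /= [-> lt_b]]; by exists b.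
Qed.

Lemma extend_eq0 (K : nat -> nat -> series) (F : series) m a :
  (forall n b, K n b m a = 0) -> extend K F m a = 0.
Proof.
move=> K0; rewrite (@extend_row _ _ _ _ 0%N 0%N) ?big_nil // => n b.
by rewrite K0 eqxx.
Qed.

(** * The two functional equations, row by row *)

Section Series.

Variables (p : nat -> nat -> nat -> nat -> bool) (sigma : vincular 4).
Variable mid : nat -> nat -> nat.
Hypothesis p_lt : forall a b c x, p a b c x -> (a < b < c)%N.
Hypothesis p_homo : forall f : nat -> nat, {mono f : x y / (x < y)%N} ->
  forall a b c x, p (f a) (f b) (f c) (f x) = p a b c x.
Hypothesis free_mid : forall n (s : 'S_n.+1) a b, let u := word s in
  (0 < a <= nth 0 u 0)%N -> (0 < b)%N ->
  [&& free_at p a (map (bump a) (b :: map (bump b) u)),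
      free_at p b (map (bump b) u), (a <= b)%N & (b <= nth 0 u 0)%N]
  = (mid a (nth 0 u 0) == b)%N && free_at p a (map (bump a) u).
Hypothesis mid_in : forall a c, (0 < a <= c)%N -> (0 < mid a c <= c)%N.
Hypothesis sigma_p : forall n (pi : 'S_n),
  contains sigma pi = ~~ avoids p (word pi).

Lemma first_letter_gfE (d : forall n, 'S_n -> bool) n a :
  first_letter_gf sigma d n.+2 a =
  (\sum_(s : 'S_n.+2)
     (avoids p (word s) && d _ s && (nth 0 (word s) 0 == a))%N)%:R.
Proof.
rewrite /first_letter_gf /= -sum1_card big_mkcond; congr _%:R.
apply: eq_bigr => s _; rewrite !inE sigma_p negbK /letter /= andbA.
by case: (_ && _).
Qed.

Lemma F1E n a : F1 sigma n.+2 a = (num_desc p n.+2 a)%:R.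
Proof.
have -> : F1 sigma n.+2 a = monomial 1 1 n.+2 a + first_letter_gf sigma
   (fun n pi => (letter pi 2%N < letter pi 1%N)%N) n.+2 a by [].
by rewrite first_letter_gfE add0r.
Qed.

Lemma F2E n a : F2 sigma n.+2 a = (num_asc p n.+2 a)%:R.
Proof. exact: first_letter_gfE. Qed.

(** The first two letters form a descent or an ascent, and the term zx of [F1] is the one-letter
    permutation. *)
Lemma F12E n a : (F1 sigma + F2 sigma) n.+1 a = (num_head p n.+1 a)%:R.
Proof.
have -> : (F1 sigma + F2 sigma) n.+1 a = F1 sigma n.+1 a + F2 sigma n.+1 a.
  by [].
case: n => [|n]; last by rewrite F1E F2E num_head_split natrD.
rewrite /F1 /F2 /first_letter_gf /= addr0.
have -> : forall f g : series, (f + g) 1%N a = f 1%N a + g 1%N a by [].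
rewrite addr0 /monomial eqxx /=; congr _%:R.
have [->|a_neq1] := eqVneq a 1%N.
  rewrite /num_head big_word_head // -[LHS]/(true : nat) (eq_bigr (fun=> 1%N)).
    by rewrite sum1_card card_Sn.
  by move=> s _; rewrite (size0nil (size_word s)).
rewrite /num_head big_word_head_out //; lia.
Qed.

Lemma F12_0 a : (F1 sigma + F2 sigma) 0%N a = 0.
Proof. by rewrite -[LHS]/(0 + 0 + 0 : rat) !addr0. Qed.

Lemma F1_rec : F1 sigma = monomial 1%N 1%N + P21 (F1 sigma + F2 sigma).
Proof.
apply/funext => m; apply/funext => a.
have -> : forall f g : series, (f + g) m a = f m a + g m a by [].
case: m => [|n].
  rewrite [P21 _ _ _]extend_eq0 // => n b; by rewrite K21E.
rewrite [P21 _ _ _](@extend_row _ _ _ _ n n.+1); last first.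
  by move=> n' b; rewrite K21E pnatr_eq0 eqb0 negbK eqSS => /andP[/eqP <-]; lia.
(* In row 1, [P21] reads the zero row 0, so only zx remains. *)
case: n => [|n].
  by rewrite big1 => [|b _]; [exact: erefl|rewrite F12_0 mul0r].
rewrite add0r F1E num_desc_recl // natr_sum; apply: eq_bigr => b _.
by rewrite F12E K21E eqxx natrM.
Qed.

Lemma P123E F n a : P123 F n.+1 a = F n a.
Proof.
rewrite [LHS](@extend_row _ _ _ _ n a.+1); last first.
  by move=> n' b /monomial_neq0 [[->] ->].
rewrite big_nat_recr //= /K123 /monomial !eqxx mulr1.
rewrite big_nat big1 ?add0r // => b lt_b.
by rewrite [a == b]gtn_eqF ?andbF ?mulr0.
Qed.

Lemma F2_rec : F2 sigma = monomial 2%N 1%N + P132 (F1 sigma + F2 sigma)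
             + P231 (F1 sigma + F2 sigma) + P123 (F2 sigma).
Proof.
apply/funext => m; apply/funext => a.
have addE : forall f g : series, (f + g) m a = f m a + g m a by [].
rewrite !addE {addE}.
(* Rows 0 and 1 vanish on both sides: [P132] and [P231] raise the degree by 2, and [F2] starts in
   row 2. *)
case: m => [|[|n]].
- rewrite [P132 _ _ _]extend_eq0 => [|n b]; last by rewrite K132E.
  rewrite [P231 _ _ _]extend_eq0 => [|n b]; last by rewrite K231E.
  by rewrite [P123 _ _ _]extend_eq0.
- rewrite [P132 _ _ _]extend_eq0 => [|n b]; last by rewrite K132E.
  rewrite [P231 _ _ _]extend_eq0 => [|n b]; last by rewrite K231E.
  by rewrite P123E.
rewrite P123E [P132 _ _ _](@extend_row _ _ _ _ n n.+1); last first.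
  move=> n' b; rewrite K132E pnatr_eq0 muln_eq0 eqb0 negb_or negbK !eqSS; lia.
rewrite [P231 _ _ _](@extend_row _ _ _ _ n n.+1); last first.
  move=> n' b; rewrite K231E pnatr_eq0 muln_eq0 eqb0 negb_or negbK !eqSS; lia.
rewrite -[_ + _ + (\sum_(_ <= _ < _) _)]addrA -big_split /= F2E.
(* In row 2 all operator terms vanish, and [z^2 x] is the permutation 12. *)
case: n => [|n].
  rewrite big1 => [|b _]; last by rewrite F12_0 !mul0r addr0.
  rewrite !addr0 /monomial eqxx /=; congr _%:R.
  pose P w := avoids p w && (nth 0 w 0 < nth 0 w 1)%N.
  have [a_in|a_out] := boolP (0 < a <= 2)%N; last first.
    by rewrite /num_asc (big_word_head_out P) //; lia.
  rewrite /num_asc (big_word_head P) //.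
  rewrite (eq_bigr (fun=> nat_of_bool (a == 1%N))).
    by rewrite sum_nat_const card_Sn mul1n.
  move=> s _; have [c [t uE]] := word_consP s; have := size_word s.
  have := nth0_word s; rewrite uE /P => /= c_in; case: t uE => // uE _.
  by rewrite /bump /=; lia.
(* From row 3 on, double ascents give the [P123] term and peaks the other two together. *)
rewrite add0r num_asc_split (num_asc2_recl p_homo free_mid mid_in) F2E natrD.
congr (_ + _).
rewrite num_peak_recl // natr_sum; apply: eq_bigr => c _.
by rewrite F12E K132E K231E !eqxx /= natrM sum_peak_tops natrD mulrDr.
Qed.

End Series.

(** * Specialisation to 124-3 and 134-2 *)

Theorem theorem4p1 (sigma : vincular 4)
    (Hsigma : sigma = vinc_124_3 \/ sigma = vinc_134_2) :
  F1 sigma = monomial 1%N 1%N + P21 (F1 sigma + F2 sigma) /\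
  F2 sigma = monomial 2%N 1%N + P132 (F1 sigma + F2 sigma)
             + P231 (F1 sigma + F2 sigma) + P123 (F2 sigma).
Proof.
case: Hsigma => ->.
  have p_lt a b c x : p124_3 a b c x -> (a < b < c)%N by case/and3P; lia.
  have p_homo f : {mono f : x y / (x < y)%N} ->
      forall a b c x, p124_3 (f a) (f b) (f c) (f x) = p124_3 a b c x.
    by move=> f_mono a b c x; rewrite /p124_3 !f_mono.
  have sigma_p n (pi : 'S_n) :
      contains vinc_124_3 pi = ~~ avoids p124_3 (word pi).
    exact: contains_avoids p124_3P.
  split; first exact: F1_rec p_lt p_homo sigma_p.
  apply: (F2_rec (mid := fun _ c => c) p_lt p_homo free_mid_124_3 _ sigma_p).
  by move=> a c; lia.
have p_lt a b c x : p134_2 a b c x -> (a < b < c)%N by case/and3P; lia.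
have p_homo f : {mono f : x y / (x < y)%N} ->
    forall a b c x, p134_2 (f a) (f b) (f c) (f x) = p134_2 a b c x.
  by move=> f_mono a b c x; rewrite /p134_2 !f_mono.
have sigma_p n (pi : 'S_n) :
    contains vinc_134_2 pi = ~~ avoids p134_2 (word pi).
  exact: contains_avoids p134_2P.
split; first exact: F1_rec p_lt p_homo sigma_p.
apply: (F2_rec (mid := fun a _ => a) p_lt p_homo free_mid_134_2 _ sigma_p).
by move=> a c; lia.
Qed.
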